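(* Let $n > 2f$. In an anonymous asynchronous message-passing system of $n$ processes, at most $f$ of which may crash, augmented with the failure detector $\Theta$, Algorithm 3 (given in the context) solves the (binary) consensus problem: every execution satisfies Termination, Irrevocability (Integrity), Agreement and Validity.
   Context: Model. $P=\{p_1,\dots,p_n\}$ is a set of $n$ processes; time ranges over $\mathbb{N}$. A failure pattern is a function $F:\mathbb{N}\to 2^P$, where $F(t)$ is the set of processes that have crashed by time $t$; processes fail only by crashing (halting permanently), so $F(t)\subseteq F(t+1)$. Put $crashed(F)=\bigcup_{t}F(t)$ and $correct(F)=P\setminus crashed(F)$; at least one process is correct, and $|crashed(F)|\le f$. The system is asynchronous: every pair of processes is connected by a reliable channel, with unbounded but finite message delays. The primitive broadcast$(m)$ sends $m$ to every process, including the sender. The system is anonymous: all processes run the same code, and a receiver cannot tell who sent a message; formally, if $R_i(j,t)$ is the value process $i$ receives from process $j$ at time $t$, the anonymous receive operation yields $R_i^{\Pi}(j,t)=R_i(\Pi(j),t)$ for a permutation $\Pi$ of $P$. Received messages are placed in a multiset $received$. Only messages of the round a process is currently in are considered; messages of later rounds are delayed until that round starts, and those of earlier rounds may be discarded. Failure detector $\Theta$. A history is a function $H:P\times\mathbb{N}\to\{true,false\}$. It is admissible for $F$ iff (Eventual Self-Trust) there are $t\in\mathbb{N}$ and $p\in correct(F)$ such that for all $t'>t$: $H(p,t')=true$ and $H(q,t')=false$ for all $q\in correct(F)\setminus\{p\}$. In the algorithm, $\Theta$ denotes the current output of the local module. Consensus. Each process has an input (proposed) value in $\{0,1\}$. Termination: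 every correct process eventually decides some value. Irrevocability (Integrity): every process decides at most once. Agreement: no two correct processes decide differently. Validity: if a process decides $v$, then $v$ was proposed by some process. Algorithm 3 (code for each process; ''$\_$'' stands for an arbitrary entry, ''?'' is a special symbol not in $\{0,1\}$). Initially $v\in\{0,1\}$ is the input value and $r\leftarrow 0$. Loop forever: (1) wait until $\Theta=true$ or $received$ contains $(Leader,r,\_)$ at least once; (2) if some $(Leader,r,w)$ has been received then $v\leftarrow w$; else, if $\Theta=true$, broadcast $(Leader,r,v)$; (3) broadcast $(Report,r,v)$; (4) wait until $received$ contains $(Report,r,\_)$ at least $n-f$ times; (5) if there is $w$ such that $(Report,r,w)$ has been received from more than $n/2$ processes then $aux\leftarrow w$, else $aux\leftarrow ?$; (6) broadcast $(Vote,r,aux)$; (7) wait until $received$ contains $(Vote,r,\_)$ at least $n-f$ times; (8) if some $(Vote,r,aux')$ with $aux'\ne ?$ has been received then $v\leftarrow aux'$; (9) if $(Vote,r,aux')$ with $aux'\neq ?$ has been received at least $n-f$ times then broadcast $(Decide,v)$; (10) $r\leftarrow r+1$. In addition, upon reception of a message $(Decide,v)$ at any time: broadcast $(Decide,v)$, decide $v$, halt. *)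

(* Defs.v *)
From HB Require Import structures.
From mathcomp Require Import all_boot perm.
From mathcomp Require Import finmap multiset.
From mathcomp Require Import boolp.

Set Implicit Arguments.
Unset Strict Implicit.
Unset Printing Implicit Defensive.

Local Open Scope mset_scope.

(* Values in {0,1} are booleans; the auxiliary value "?" is [None]. *)

Inductive message :=
  | Leader of nat & bool
  | Report of nat & bool
  | Vote of nat & option bool
  | Decide of bool.

Definition message_code (m : message) :
    (nat * bool) + (nat * bool) + (nat * option bool) + bool :=
  match m with
  | Leader r w => inl (inl (inl (r, w)))
  | Report r w => inl (inl (inr (r, w)))
  | Vote r a => inl (inr (r, a))
  | Decide w => inr w
  end.

Definition message_decode
    (c : (nat * bool) + (nat * bool) + (nat * option bool) + bool) : message :=
  match c with
  | inl (inl (inl (r, w))) => Leader r w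
  | inl (inl (inr (r, w))) => Report r w
  | inl (inr (r, a)) => Vote r a
  | inr w => Decide w
  end.

Lemma message_codeK : cancel message_code message_decode.
Proof. by case. Qed.

HB.instance Definition _ := Choice.copy message (can_type message_codeK).

(** * The algorithm *)

(* The loop body, executed with r = 0, 1, 2, ...:
    (1) wait until theta = true or received contains (Leader, r, _);
    (2) if some (Leader, r, w) has been received then v <- w
        else if theta = true, broadcast (Leader, r, v);
    (3) broadcast (Report, r, v);
    (4) wait until received contains (Report, r, _) at least n - f times;
    (5) if some (Report, r, w) has been received more than n/2 times
        then aux <- w else aux <- ?;
    (6) broadcast (Vote, r, aux);
    (7) wait until received contains (Vote, r, _) at least n - f times;
    (8) if some (Vote, r, w) with w <> ? has been received then v <- w;
    (9) if some (Vote, r, w) with w <> ? has been received at least n - f times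
        then broadcast (Decide, v);
    (10) r <- r + 1.
   In addition, upon reception of (Decide, w) at any time: broadcast
   (Decide, w), decide w, halt.
   [Line k] is the program point just before (k). The test of (1) and (2) form
   a single atomic action, with a single reading of theta: if theta could change
   in between, the only leader of a round might go on without broadcasting
   its value, which would block the other processes forever. *)
Inductive location :=
  | Line1 | Line3 | Line4 | Line5 | Line6 | Line7 | Line8 | Line9 | Line10
  | Halted.

(* [received] keeps the messages of every round; the code of round r looks only
   at the entries tagged r. *)
Record lstate := LState {
  loc : location;
  estimate : bool;
  round : nat;
  aux : option bool;
  received : {mset message}
}.

(* The initial value of [aux] is irrelevant: (5) sets it before (6) reads it. *)
Definition init_state (input : bool) : lstate :=
  LState Line1 input 0 None mset0.

Definition num_reports (r : nat) (M : {mset message}) : nat :=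
  \sum_(w : bool) M (Report r w).

Definition num_votes (r : nat) (M : {mset message}) : nat :=
  \sum_(a : option bool) M (Vote r a).

(* [loop_step n f theta s out s']: with current failure detector output
   [theta], the main loop goes from [s] to [s'] and broadcasts [out], if any. *)
Inductive loop_step (n f : nat) (theta : bool) :
    lstate -> option message -> lstate -> Prop :=
  | Line1_wait v r a (M : {mset message}) :
      ~~ theta -> (forall w, Leader r w \notin M) ->
      loop_step n f theta (LState Line1 v r a M) None (LState Line1 v r a M)
  | Line2_adopt v r a (M : {mset message}) w :
      Leader r w \in M ->
      loop_step n f theta (LState Line1 v r a M) None (LState Line3 w r a M)
  | Line2_lead v r a (M : {mset message}) :
      theta -> (forall w, Leader r w \notin M) ->
      loop_step n f theta (LState Line1 v r a M)
        (Some (Leader r v)) (LState Line3 v r a M)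
  | Line3_report v r a (M : {mset message}) :
      loop_step n f theta (LState Line3 v r a M)
        (Some (Report r v)) (LState Line4 v r a M)
  | Line4_wait v r a (M : {mset message}) :
      num_reports r M < n - f ->
      loop_step n f theta (LState Line4 v r a M) None (LState Line4 v r a M)
  | Line4_go v r a (M : {mset message}) :
      n - f <= num_reports r M ->
      loop_step n f theta (LState Line4 v r a M) None (LState Line5 v r a M)
  | Line5_majority v r a (M : {mset message}) w :
      n < 2 * M (Report r w) ->
      loop_step n f theta (LState Line5 v r a M)
        None (LState Line6 v r (Some w) M)
  | Line5_none v r a (M : {mset message}) :
      (forall w, ~~ (n < 2 * M (Report r w))) ->
      loop_step n f theta (LState Line5 v r a M) None (LState Line6 v r None M)
  | Line6_vote v r a (M : {mset message}) :
      loop_step n f theta (LState Line6 v r a M)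
        (Some (Vote r a)) (LState Line7 v r a M)
  | Line7_wait v r a (M : {mset message}) :
      num_votes r M < n - f ->
      loop_step n f theta (LState Line7 v r a M) None (LState Line7 v r a M)
  | Line7_go v r a (M : {mset message}) :
      n - f <= num_votes r M ->
      loop_step n f theta (LState Line7 v r a M) None (LState Line8 v r a M)
  | Line8_adopt v r a (M : {mset message}) w :
      Vote r (Some w) \in M ->
      loop_step n f theta (LState Line8 v r a M) None (LState Line9 w r a M)
  | Line8_keep v r a (M : {mset message}) :
      (forall w, Vote r (Some w) \notin M) ->
      loop_step n f theta (LState Line8 v r a M) None (LState Line9 v r a M)
  | Line9_decide v r a (M : {mset message}) w :
      n - f <= M (Vote r (Some w)) ->
      loop_step n f theta (LState Line9 v r a M)
        (Some (Decide v)) (LState Line10 v r a M)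
  | Line9_skip v r a (M : {mset message}) :
      (forall w, M (Vote r (Some w)) < n - f) ->
      loop_step n f theta (LState Line9 v r a M) None (LState Line10 v r a M)
  | Line10_next v r a (M : {mset message}) :
      loop_step n f theta (LState Line10 v r a M)
        None (LState Line1 v r.+1 a M).

(* [code_step n f theta s out dec s']: one atomic action of the code, in which
   the process also decides [dec], if any. The Decide handler has priority over
   the main loop. The process identity is not a parameter. *)
Inductive code_step (n f : nat) (theta : bool) :
    lstate -> option message -> option bool -> lstate -> Prop :=
  | Step_halted s :
      loc s = Halted -> code_step n f theta s None None s
  | Step_decide s w :
      loc s <> Halted -> Decide w \in received s ->
      code_step n f theta s (Some (Decide w)) (Some w)
        (LState Halted (estimate s) (round s) (aux s) (received s))
  | Step_loop s out s' :
      (forall w, Decide w \notin received s) ->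
      loop_step n f theta s out s' ->
      code_step n f theta s out None s'.

(** * Failure patterns and failure detector histories *)

Definition crashed (n : nat) (F : nat -> {set 'I_n}) : {set 'I_n} :=
  [set i | `[< exists t, i \in F t >]].

Definition correct (n : nat) (F : nat -> {set 'I_n}) : {set 'I_n} :=
  ~: crashed F.

Definition failure_pattern (n f : nat) (F : nat -> {set 'I_n}) : Prop :=
  [/\ forall t, F t \subset F t.+1,
      exists i, i \in correct F
    & #|crashed F| <= f].

Definition eventual_self_trust (n : nat) (F : nat -> {set 'I_n})
    (H : 'I_n -> nat -> bool) : Prop :=
  exists t p, p \in correct F /\
    forall t', t < t' ->
      H p t' = true /\ forall q, q \in correct F :\ p -> H q t' = false.

(** * Executions *)

(* At each time t, every process in [sched t] takes one atomic step: it receives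
   at most one message on each incoming channel and then performs an action of
   its code, which broadcasts at most one message.
   [origin i j t = Some t'] means that process i receives at time t the message
   that j broadcast at time t'; a sent message is thus identified by its sender
   and its sending time, even if its content is sent several times. *)
Record execution (n : nat) := Execution {
  state : 'I_n -> nat -> lstate;                  (* just before time t *)
  sched : nat -> {set 'I_n};
  sent : 'I_n -> nat -> option message;
  decides : 'I_n -> nat -> option bool;
  origin : 'I_n -> 'I_n -> nat -> option nat;
  permut : 'I_n -> nat -> {perm 'I_n}
}.

(* The value R_i(j,t) received by i from j at time t. *)
Definition recv (n : nat) (e : execution n) (i j : 'I_n) (t : nat) :
    option message :=
  obind (sent e j) (origin e i j t).

(* The anonymous receive operation; the permutation may be different for each
   receiver and each time. *)
Definition anon_recv (n : nat) (e : execution n) (i j : 'I_n) (t : nat) :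
    option message :=
  recv e i (permut e i t j) t.

Definition receive (s : lstate) (ms : seq message) : lstate :=
  LState (loc s) (estimate s) (round s) (aux s) (received s `+` seq_mset ms).

Definition reliable_channels (n : nat) (F : nat -> {set 'I_n})
    (e : execution n) : Prop :=
  [/\ (* no message is created *)
      forall i j t t', origin e i j t = Some t' ->
        [/\ i \in sched e t, t' < t & sent e j t'],
      (* no message is duplicated *)
      forall i j t1 t2 t', origin e i j t1 = Some t' ->
        origin e i j t2 = Some t' -> t1 = t2
    & (* no message to a correct process is lost *)
      forall i j t', i \in correct F -> sent e j t' ->
        exists t, origin e i j t = Some t'].

Definition scheduling (n : nat) (F : nat -> {set 'I_n})
    (e : execution n) : Prop :=
  (forall t i, i \in sched e t -> i \notin F t) /\
  (forall i t, i \in correct F -> exists2 t', t <= t' & i \in sched e t').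

Definition follows_code (n f : nat) (H : 'I_n -> nat -> bool)
    (input : 'I_n -> bool) (e : execution n) : Prop :=
  [/\ forall i, state e i 0 = init_state (input i),
      forall i t, i \in sched e t ->
        code_step n f (H i t)
          (receive (state e i t) (pmap (fun j => anon_recv e i j t) (enum 'I_n)))
          (sent e i t) (decides e i t) (state e i t.+1)
    & forall i t, i \notin sched e t ->
        [/\ sent e i t = None, decides e i t = None
          & state e i t.+1 = state e i t]].

Definition is_execution (n f : nat) (F : nat -> {set 'I_n})
    (H : 'I_n -> nat -> bool) (input : 'I_n -> bool) (e : execution n) : Prop :=
  [/\ reliable_channels F e, scheduling F e & follows_code f H input e].

(** * Consensus *)

Definition termination (n : nat) (F : nat -> {set 'I_n})
    (e : execution n) : Prop :=
  forall i, i \in correct F -> exists t w, decides e i t = Some w.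

Definition integrity (n : nat) (e : execution n) : Prop :=
  forall i t1 t2 w1 w2,
    decides e i t1 = Some w1 -> decides e i t2 = Some w2 -> t1 = t2.

Definition agreement (n : nat) (F : nat -> {set 'I_n})
    (e : execution n) : Prop :=
  forall i j t1 t2 w1 w2, i \in correct F -> j \in correct F ->
    decides e i t1 = Some w1 -> decides e j t2 = Some w2 -> w1 = w2.

Definition validity (n : nat) (input : 'I_n -> bool)
    (e : execution n) : Prop :=
  forall i t w, decides e i t = Some w -> exists j, input j = w.

(* Main.v *)
(** Safety. Every value in circulation descends from a Leader message: a Vote of
    w in round r needs a majority of Reports of w, a Report of w needs a Leader
    message (r, w), and a Leader message (r+1, w) needs one (r, w); going down to
    round 0 yields Validity. Each process sends at most one Report and one Vote
    per round, so quorums of senders intersect: the votes other than ? of a round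
    agree, and if n - f processes vote w in round r then every process ends round
    r with estimate w, so that all later rounds only see w; this is Agreement.

    Termination. One Decide message makes all correct processes decide. If none
    is ever sent, no correct process is blocked: at Line 1 the eventual leader p
    either leads or is itself released by some Leader message, which reaches
    everybody, and the correct processes alone fill the quorums of n - f. Take a
    round that nobody has reached when the detector has stabilized and the faulty
    processes have stopped: p is its only leader, so all its Reports and Votes
    carry the same value, and p broadcasts Decide at Line 9. *)

Require Import Defs.
From mathcomp Require Import all_boot perm.
From mathcomp Require Import finmap multiset.
From mathcomp Require Import boolp zify.

Set Implicit Arguments.
Unset Strict Implicit.
Unset Printing Implicit Defensive.

(* [Halted] gets the largest index, so that [progress] never decreases, whatever
   the line at which a process halts. *)
Definition line_index (l : location) : nat :=
  match l with
  | Line1 => 0 | Line3 => 1 | Line4 => 2 | Line5 => 3 | Line6 => 4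
  | Line7 => 5 | Line8 => 6 | Line9 => 7 | Line10 | Halted => 8
  end.

Definition progress (s : lstate) : nat := 9 * round s + line_index (loc s).

(* The progress value at which [m] is broadcast; it determines the type and the
   round of [m]. [Decide] can be broadcast at any line. *)
Definition slot (m : message) : option nat :=
  match m with
  | Leader r _ => Some (9 * r)
  | Report r _ => Some (9 * r + 1)
  | Vote r _ => Some (9 * r + 4)
  | Decide _ => None
  end.

(** * Single steps of the code *)

Lemma progress_loc s r l : loc s <> Halted -> l <> Halted ->
  progress s = 9 * r + line_index l -> loc s = l /\ round s = r.
Proof.
by rewrite /progress; case: (loc s) => //; case: l => //= _ _; split=> //; lia.
Qed.

Section Steps.
Variables (n f : nat) (theta : bool).
Implicit Types (s : lstate) (out : option message) (dec : option bool).

Lemma loop_step_received s out s' :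
  loop_step n f theta s out s' -> received s' = received s.
Proof. by case. Qed.

Lemma code_step_received s out dec s' :
  code_step n f theta s out dec s' -> received s' = received s.
Proof. by case=> // {}s out' {}s' _ /loop_step_received. Qed.

Lemma loop_step_progress s out s' : loop_step n f theta s out s' ->
  progress s <= progress s' <= (progress s).+1.
Proof. by case=> *; rewrite /progress /=; lia. Qed.

Lemma code_step_progress s out dec s' : code_step n f theta s out dec s' ->
  progress s <= progress s'.
Proof.
case=> [//|{}s w hl hw|{}s out' {}s' _ /loop_step_progress/andP[]//].
by rewrite /progress /=; case: (loc s) => /=; lia.
Qed.

(** Such a broadcast always moves [progress] past its slot, so no slot can be used twice. *)
Lemma code_step_slot s m dec s' k :
  code_step n f theta s (Some m) dec s' -> slot m = Some k ->
  progress s = k /\ progress s' = k.+1.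
Proof.
move E : (Some m) => out hs; case: hs E => [//|{}s w hl hw [->]//|].
move=> {}s out' {}s' _; case=> // v r a M *.
all: match goal with H : Some _ = Some _ |- _ => case: H => ?; subst m end.
all: match goal with H : slot _ = Some _ |- _ => case: H => //= <- end.
all: by rewrite /progress /=; lia.
Qed.

Lemma code_step_sent s m dec s' : code_step n f theta s (Some m) dec s' ->
  match m with
  | Leader r w => [/\ loc s = Line1, round s = r, estimate s = w & theta]
  | Report r w => [/\ loc s = Line3, round s = r & estimate s = w]
  | Vote r a => [/\ loc s = Line6, round s = r & aux s = a]
  | Decide w => Decide w \in received s \/
      [/\ loc s = Line9, estimate s = w &
          exists w', n - f <= received s (Vote (round s) (Some w'))]
  end.
Proof.
move E : (Some m) => out hs; case: hs E => [//|{}s w hl hw [->]|].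
  by left.
move=> {}s out' {}s' _; case=> // v r a M; try by case=> ->.
- by move=> hth _ [->].
- by move=> w hw [->]; right; split=> //; exists w.
Qed.

Lemma loop_step_running s out s' : loop_step n f theta s out s' ->
  loc s <> Halted /\ loc s' <> Halted.
Proof. by case. Qed.

Lemma code_step_halted s out dec s' : code_step n f theta s out dec s' ->
  loc s = Halted -> loc s' = Halted.
Proof. by case=> // {}s out' {}s' _ /loop_step_running[]. Qed.

Lemma code_step_halt s out dec s' : code_step n f theta s out dec s' ->
  loc s' = Halted -> loc s = Halted \/ exists w, dec = Some w.
Proof.
case=> [{}s hl _|{}s w _ _ _|{}s out' {}s' _ /loop_step_running[]//].
- by left.
- by right; exists w.
Qed.

Lemma code_step_decision s out w s' : code_step n f theta s out (Some w) s' ->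
  loc s <> Halted /\ loc s' = Halted.
Proof. by move E : (Some w) => dec hs; case: hs E. Qed.

Lemma code_step_must_decide s out dec s' w :
  code_step n f theta s out dec s' -> loc s <> Halted ->
  Decide w \in received s -> exists w', dec = Some w'.
Proof.
case=> // [{}s w' _ _ _ _|{}s out' {}s' hw _ _ h]; first by exists w'.
by have := hw w; rewrite h.
Qed.

Lemma code_step_loop s out dec s' : code_step n f theta s out dec s' ->
  loc s <> Halted -> (forall w, Decide w \notin received s) ->
  loop_step n f theta s out s'.
Proof. by case=> // {}s w _ h _ /(_ w); rewrite h. Qed.

(** Only the three waiting rules leave [progress] unchanged; (10) increases it by one as well, from
    index 8 of one round to index 0 of the next. *)
Lemma loop_step_stuck s out s' :
  loop_step n f theta s out s' -> progress s' = progress s ->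
  match loc s with
  | Line1 => ~~ theta /\ forall w, Leader (round s) w \notin received s
  | Line4 => num_reports (round s) (received s) < n - f
  | Line7 => num_votes (round s) (received s) < n - f
  | _ => False
  end.
Proof. by rewrite /progress; case=> //= *; lia. Qed.

Lemma loop_step_sent s out s' :
  loop_step n f theta s out s' -> progress s < progress s' ->
  match loc s with
  | Line1 => exists w, Leader (round s) w \in received s \/
                       out = Some (Leader (round s) w)
  | Line3 => out = Some (Report (round s) (estimate s))
  | Line6 => out = Some (Vote (round s) (aux s))
  | Line9 => n - f <= num_votes (round s) (received s) ->
             (exists w, forall a, Vote (round s) a \in received s -> a = Some w) ->
             exists w, out = Some (Decide w)
  | _ => True
  end.
Proof.
case=> //= v r a M.
- by rewrite ltnn.
- by move=> w hw _; exists w; left.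
- by move=> _ _ _; exists v; right.
- by move=> *; exists v.
(* Skipping (9) is impossible here: all received votes are for [w], so their count is the whole of
   [num_votes]. *)
- move=> hM _ hv [w hw]; have := hM w; rewrite ltnNge => /negP[].
  suff <- : num_votes r M = M (Vote r (Some w)) by [].
  apply: big_only1 => // b bw _; apply/mset_eq0P.
  by apply: contra bw => /hw->.
Qed.

End Steps.

(** * Safety *)

Section Execution.
Variables (n f : nat) (F : nat -> {set 'I_n}) (H : 'I_n -> nat -> bool).
Variables (input : 'I_n -> bool) (e : execution n).
Hypothesis he : is_execution f F H input e.

(** * Receptions traced back to broadcasts *)

Definition received_state (i : 'I_n) (t : nat) : lstate :=
  receive (state e i t) (pmap (fun j => anon_recv e i j t) (enum 'I_n)).

Lemma code_stepP i t : i \in sched e t ->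
  code_step n f (H i t) (received_state i t) (sent e i t) (decides e i t)
    (state e i t.+1).
Proof. by case: he => _ _ [_ + _]; apply. Qed.

Lemma state0 i : state e i 0 = init_state (input i).
Proof. by case: he => _ _ []. Qed.

Lemma state_idle i t : i \notin sched e t -> state e i t.+1 = state e i t.
Proof. by case: he => _ _ [_ _ hidle] /hidle[]. Qed.

Lemma sent_sched i t m : sent e i t = Some m -> i \in sched e t.
Proof.
move=> hm; apply/negPn/negP => hi.
by case: he => _ _ [_ _ /(_ i t hi)[]]; rewrite hm.
Qed.

Lemma decides_sched i t w : decides e i t = Some w -> i \in sched e t.
Proof.
move=> hm; apply/negPn/negP => hi.
by case: he => _ _ [_ _ /(_ i t hi)[]]; rewrite hm.
Qed.

Lemma origin_sched i j t t' : origin e i j t = Some t' ->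
  [/\ i \in sched e t, t' < t & sent e j t'].
Proof. by case: he => [[+ _ _] _ _]; apply. Qed.

Lemma recvP i j t m : recv e i j t = Some m ->
  exists t', [/\ origin e i j t = Some t', t' < t & sent e j t' = Some m].
Proof.
rewrite /recv; case E: (origin e i j t) => [t'|] //= hm; exists t'.
by have [] := origin_sched E.
Qed.

(** The multiset only depends on the sum over all senders, which a permutation leaves unchanged:
    anonymity disappears from here on. *)
Lemma received_stateD i t m :
  received (received_state i t) m =
  received (state e i t) m + \sum_j (recv e i j t == Some m).
Proof.
rewrite /= msetE2 mset_seqE; congr addn.
rewrite (reindex_perm (permut e i t)) -big_enum /=.
elim: (enum 'I_n) => [|j s IH]; first by rewrite big_nil.
rewrite big_cons -IH /= /anon_recv.
by case: (recv e i _ t) => [m'|] //=; rewrite (inj_eq (@Some_inj _)).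
Qed.

Lemma received_next i t m :
  received (state e i t.+1) m =
  received (state e i t) m + \sum_j (recv e i j t == Some m).
Proof.
case: (boolP (i \in sched e t)) => hi.
  by rewrite (code_step_received (code_stepP hi)) received_stateD.
rewrite state_idle // big1 ?addn0 // => j _.
case E: (recv e i j t) => [m'|] //.
by have [t' [/origin_sched[]]] := recvP E; rewrite (negPf hi).
Qed.

Lemma received_state_next i t : i \in sched e t ->
  received (received_state i t) = received (state e i t.+1).
Proof. by move=> /code_stepP/code_step_received. Qed.

Lemma received_count i t m :
  received (state e i t) m = \sum_(s < t) \sum_j (recv e i j s == Some m).
Proof.
elim: t => [|t IH]; first by rewrite state0 big_ord0 mset0E.
by rewrite big_ord_recr /= received_next IH.
Qed.

Lemma received_sent i t m : m \in received (state e i t) ->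
  exists j s, s.+1 < t /\ sent e j s = Some m.
Proof.
rewrite in_mset received_count lt0n sum_nat_eq0 => /forallPn[s].
rewrite sum_nat_eq0 => /forallPn[j]; rewrite /= eqb0 negbK => /eqP.
by move=> /recvP[t' [_ ht' hs]]; exists j, t'; split=> //;
  apply: leq_ltn_trans ht' _.
Qed.

(** The strict inequality [s < t] is what allows induction on sending times. *)
Lemma receivable_sent i t m : i \in sched e t ->
  m \in received (received_state i t) ->
  exists j s, s < t /\ sent e j s = Some m.
Proof. by move=> /received_state_next-> /received_sent. Qed.

Lemma sent_recv i j s m : i \in correct F -> sent e j s = Some m ->
  exists t, recv e i j t = Some m.
Proof.
move=> hi hs; case: he => [[_ _ +] _ _] => /(_ i j s hi).
by rewrite hs => -[//|t ht]; exists t; rewrite /recv ht.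
Qed.

Lemma recv_received i j s t m : recv e i j s = Some m -> s < t ->
  m \in received (state e i t).
Proof.
move=> hr st; rewrite in_mset received_count (bigD1 (Ordinal st)) //=.
by rewrite (bigD1 j) //= hr eqxx.
Qed.

Lemma sent_received i j s m : i \in correct F -> sent e j s = Some m ->
  exists T, forall t, T <= t -> m \in received (state e i t).
Proof.
move=> hi /(sent_recv hi)[T hT]; exists T.+1 => t; exact: recv_received hT.
Qed.

Lemma progress_mono i t1 t2 : t1 <= t2 ->
  progress (state e i t1) <= progress (state e i t2).
Proof.
move=> /subnKC <-; elim: (t2 - t1) => [|d IH]; first by rewrite addn0.
rewrite addnS (leq_trans IH) //; set t := t1 + d.
case: (boolP (i \in sched e t)) => hi; last by rewrite state_idle.
exact: code_step_progress (code_stepP hi).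
Qed.

Lemma sent_slot i t m k : sent e i t = Some m -> slot m = Some k ->
  progress (state e i t) = k /\ progress (state e i t.+1) = k.+1.
Proof.
move=> hm; have := code_stepP (sent_sched hm); rewrite hm => hs hk.
exact: code_step_slot hs hk.
Qed.

(** After the first broadcast [progress] is [k.+1]; being monotone, it cannot be [k] again at a
    later one. *)
Lemma sent_unique i t1 t2 m1 m2 k :
  sent e i t1 = Some m1 -> sent e i t2 = Some m2 ->
  slot m1 = Some k -> slot m2 = Some k -> t1 = t2.
Proof.
wlog le12 : t1 t2 m1 m2 / t1 <= t2 => [hw|].
  case: (leqP t1 t2) => [|/ltnW] le12 s1 s2 k1 k2; first exact: hw s1 s2 k1 k2.
  by apply/esym; exact: hw s2 s1 k2 k1.
move=> s1 s2 k1 k2; apply/eqP; rewrite eqn_leq le12 /= leqNgt; apply/negP => lt12.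
have [_ p1] := sent_slot s1 k1; have [p2 _] := sent_slot s2 k2.
by have := progress_mono i lt12; rewrite p1 p2 ltnn.
Qed.

Definition senders (m : message) : {set 'I_n} :=
  [set j | `[< exists t, sent e j t = Some m >]].

Lemma sendersP j m : reflect (exists t, sent e j t = Some m) (j \in senders m).
Proof. by rewrite inE; apply: asboolP. Qed.

(** A sender contributes at most one copy: it broadcasts [m] once and channels do not duplicate.
    This turns anonymous counts into numbers of distinct processes; [Decide], which has no slot, is
    excluded. *)
Lemma received_senders i t m k : slot m = Some k ->
  received (state e i t) m <= #|senders m|.
Proof.
move=> hk; rewrite received_count exchange_big /= -sum1_card [leqRHS]big_mkcond /=.
apply: leq_sum => j _; case: ifPn => hj.
  have -> : \sum_(s < t) (recv e i j s == Some m) =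
            #|[pred s : 'I_t | recv e i j s == Some m]|.
    by rewrite -sum1_card [RHS]big_mkcond; apply: eq_bigr => s _.
  apply/card_le1_eqP => s1 s2; rewrite !inE.
  move=> /eqP/recvP[t1 [o1 _ m1]] /eqP/recvP[t2 [o2 _ m2]].
  have t12 := sent_unique m1 m2 hk hk; apply: val_inj.
  by case: he => [[_ + _] _ _] => /(_ i j _ _ t1); apply; rewrite // o2 t12.
rewrite leqn0 sum_nat_eq0; apply/forallP => s; rewrite eqb0 /=.
apply: contra hj => /eqP/recvP[t' [_ _ ht']].
by apply/sendersP; exists t'.
Qed.

(** * Quorum intersection and votes *)

Lemma quorums_meet m1 m2 : n < #|senders m1| + #|senders m2| ->
  exists j t1 t2, sent e j t1 = Some m1 /\ sent e j t2 = Some m2.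
Proof.
rewrite -cardsUI => hn.
have leU : #|senders m1 :|: senders m2| <= n.
  by rewrite -[leqRHS]card_ord max_card.
have : 0 < #|senders m1 :&: senders m2| by lia.
rewrite card_gt0 => /set0Pn[j]; rewrite inE => /andP[].
by move=> /sendersP[t1 h1] /sendersP[t2 h2]; exists j, t1, t2.
Qed.

Lemma quorums_agree m1 m2 k : n < #|senders m1| + #|senders m2| ->
  slot m1 = Some k -> slot m2 = Some k -> m1 = m2.
Proof.
move=> /quorums_meet[j [t1 [t2 [s1 s2]]]] k1 k2.
have t12 := sent_unique s1 s2 k1 k2.
by move: s1; rewrite t12 s2 => -[].
Qed.

Definition sent_by_some (m : message) : Prop := exists j t, sent e j t = Some m.

Lemma receivable_by_some i t m : i \in sched e t ->
  m \in received (received_state i t) -> sent_by_some m.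
Proof. by move=> hi /(receivable_sent hi)[j [s [_ hs]]]; exists j, s. Qed.

Hypothesis hnf : 2 * f < n.

(* Only conditions that further receptions preserve. In particular, voting ? is
   recorded as having received both values: n - f > n/2 equal reports would have
   been a majority. *)
Definition quorum_inv (s : lstate) : Prop :=
  match loc s with
  | Line3 => sent_by_some (Leader (round s) (estimate s))
  | Line5 => n - f <= num_reports (round s) (received s)
  | Line6 => if aux s is Some w then n < 2 * received s (Report (round s) w)
             else forall w, Report (round s) w \in received s
  | Line8 | Line9 => n - f <= num_votes (round s) (received s)
  | _ => True
  end.

Lemma quorum_inv_receive s ms : quorum_inv s -> quorum_inv (receive s ms).
Proof.
rewrite /quorum_inv /=.
have hle m : received s m <= (received s `+` seq_mset ms)%mset m.
  by rewrite msetE2 leq_addr.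
case: (loc s) => //.
- by move=> hs; apply: (leq_trans hs); apply: leq_sum => w _; apply: hle.
- case: (aux s) => [w hw|hw w].
    by apply: leq_trans hw _; rewrite leq_mul2l hle.
  by rewrite in_msetD hw.
- by move=> hs; apply: (leq_trans hs); apply: leq_sum => w _; apply: hle.
- by move=> hs; apply: (leq_trans hs); apply: leq_sum => w _; apply: hle.
Qed.

Lemma quorum_invP i t : quorum_inv (state e i t).
Proof.
elim: t => [|t IH]; first by rewrite state0.
case: (boolP (i \in sched e t)) => hi; last by rewrite state_idle.
have {IH} IH : quorum_inv (received_state i t) by apply: quorum_inv_receive.
have hrec m := @receivable_by_some i t m hi.
have hsent m : sent e i t = Some m -> sent_by_some m by exists i, t.
move: (code_stepP hi) hrec IH hsent.
move: (received_state i t) (state e i t.+1) (sent e i t) (decides e i t).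
move=> s0 s1 out0 dec0; case=> [s hl|s w _ _|s out s' _].
- by rewrite /quorum_inv hl.
- by [].
case=> {s s' out}; rewrite /quorum_inv /= => //.
- by move=> v r a M w /[swap] hrec /hrec.
- by move=> v r a M _ _ _ _; apply.
(* If [w] were missing, all of the at least [n - f] reports would carry [~~ w], a majority since
   [2 * f < n]. *)
- move=> v r a M hN _ hM _ w; have := hN (~~ w).
  rewrite /num_reports big_bool /= in hM; rewrite in_mset.
  by case: w => /=; lia.
Qed.

Lemma quorum_inv_received i t : quorum_inv (received_state i t).
Proof. exact: quorum_inv_receive (quorum_invP i t). Qed.

Lemma vote_majority r w : sent_by_some (Vote r (Some w)) ->
  n < 2 * #|senders (Report r w)|.
Proof.
move=> [i [t hs]]; have := code_stepP (sent_sched hs); rewrite hs.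
move=> /code_step_sent[/= hl hr ha].
have := quorum_invP i t; rewrite /quorum_inv hl hr ha => h.
by apply: leq_trans h _; rewrite leq_mul2l (@received_senders _ _ _ (9 * r + 1)).
Qed.

Lemma vote_reported r w : sent_by_some (Vote r (Some w)) ->
  sent_by_some (Report r w).
Proof.
move=> /vote_majority h; have : 0 < #|senders (Report r w)| by lia.
by rewrite card_gt0 => /set0Pn[j /sendersP[t hj]]; exists j, t.
Qed.

Lemma vote_none_reported r w : sent_by_some (Vote r None) ->
  sent_by_some (Report r w).
Proof.
move=> [i [t hs]]; have := code_stepP (sent_sched hs); rewrite hs.
move=> /code_step_sent[/= hl hr ha].
have := quorum_invP i t; rewrite /quorum_inv hl hr ha => /(_ w).
by move=> /received_sent[j [u [_ hj]]]; exists j, u.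
Qed.

Lemma votes_agree r w1 w2 : sent_by_some (Vote r (Some w1)) ->
  sent_by_some (Vote r (Some w2)) -> w1 = w2.
Proof.
move=> /vote_majority h1 /vote_majority h2.
suff [] : Report r w1 = Report r w2 by [].
by apply: (@quorums_agree _ _ (9 * r + 1)) => //; lia.
Qed.

Lemma report_led r w : sent_by_some (Report r w) -> sent_by_some (Leader r w).
Proof.
move=> [i [t hs]]; have := code_stepP (sent_sched hs); rewrite hs.
move=> /code_step_sent[/= hl hr ha].
by have := quorum_invP i t; rewrite /quorum_inv hl hr ha.
Qed.

Lemma vote_led r w : sent_by_some (Vote r (Some w)) ->
  sent_by_some (Leader r w).
Proof. by move=> /vote_reported/report_led. Qed.

(** * Values passed from round to round *)

Definition vote_quorum r w := n - f <= #|senders (Vote r (Some w))|.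

Lemma vote_quorum_sent r w : vote_quorum r w -> sent_by_some (Vote r (Some w)).
Proof.
move=> h; have : 0 < #|senders (Vote r (Some w))| by apply: leq_trans h; lia.
by rewrite card_gt0 => /set0Pn[j /sendersP[t hj]]; exists j, t.
Qed.

(** What a process knows of its estimate after (8): it descends from a leader of the round, and no
    vote quorum of the whole execution, past or future, contradicts it. *)
Definition concluded r w :=
  sent_by_some (Leader r w) /\ forall w', vote_quorum r w' -> w' = w.

(** At [Line1] the round counter has already moved on, so the conclusion refers to the predecessor
    round; round 0 has only the input. *)
Definition estimate_inv i (s : lstate) : Prop :=
  match loc s with
  | Line1 => if round s is r.+1 then concluded r (estimate s)
             else estimate s = input i
  | Line9 | Line10 => concluded (round s) (estimate s)
  | Halted => True
  | _ => sent_by_some (Leader (round s) (estimate s))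
  end.

Lemma estimate_invP i t : estimate_inv i (state e i t).
Proof.
elim: t => [|t IH]; first by rewrite state0.
case: (boolP (i \in sched e t)) => hi; last by rewrite state_idle.
have hrec m := @receivable_by_some i t m hi.
have hcount a : received (received_state i t) (Vote (round (state e i t)) a) <=
    #|senders (Vote (round (state e i t)) a)|.
  by rewrite received_state_next //; exact: received_senders.
have hquorum := quorum_inv_received i t.
have hsent m : sent e i t = Some m -> sent_by_some m by exists i, t.
move: (code_stepP hi) hrec IH hsent hcount hquorum.
have -> : estimate_inv i (state e i t) = estimate_inv i (received_state i t).
  by [].
have -> : round (state e i t) = round (received_state i t) by [].
move: (received_state i t) (state e i t.+1) (sent e i t) (decides e i t).
move=> s0 s1 out0 dec0; case=> [s hl|s w _ _|s out s' _].
- by rewrite /estimate_inv hl.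
- by [].
case=> {s s' out}; rewrite /estimate_inv /quorum_inv /= => //.
- by move=> v r a M w /[swap] hrec /hrec.
- by move=> v r a M _ _ _ _ hsent _ _; apply: hsent.
- move=> v r a M w /[swap] hrec /hrec hw _ _ _ _.
  split; first exact: vote_led.
  by move=> w' /vote_quorum_sent hw'; exact: votes_agree hw' hw.
(* Keeping the estimate means that only ? was received, hence from at least [n - f] processes. A
   vote quorum for [w] would meet them, as [2 * (n - f) > n], and a common process would have voted
   twice. *)
- move=> v r a M hM _ hv _ hcount hvotes; split=> // w hw.
  have hnone : n - f <= #|senders (Vote r None)|.
    apply: leq_trans (hcount None).
    suff <- : num_votes r M = M (Vote r None) by [].
    by apply: big_only1 => // -[b|] // _ _; apply/mset_eq0P.
  suff : Vote r None = Vote r (Some w) by [].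
  apply: (@quorums_agree _ _ (9 * r + 4)) => //.
  by move: hw; rewrite /vote_quorum; lia.
Qed.

Lemma led0_input w : sent_by_some (Leader 0 w) -> exists i, input i = w.
Proof.
move=> [i [t hs]]; have := code_stepP (sent_sched hs); rewrite hs.
move=> /code_step_sent[/= hl hr hw _]; exists i.
by have := estimate_invP i t; rewrite /estimate_inv hl hr hw.
Qed.

Lemma ledS_concluded r w : sent_by_some (Leader r.+1 w) -> concluded r w.
Proof.
move=> [i [t hs]]; have := code_stepP (sent_sched hs); rewrite hs.
move=> /code_step_sent[/= hl hr hw _].
by have := estimate_invP i t; rewrite /estimate_inv hl hr hw.
Qed.

Lemma led_input r w : sent_by_some (Leader r w) -> exists i, input i = w.
Proof. by elim: r => [/led0_input|r IH /ledS_concluded[/IH]]. Qed.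

(** Induction on [r']: the quorum forces the value with which round [r] ends, and each later leader
    value was already led in the round before. *)
Lemma led_after_quorum r r' w w' : vote_quorum r w -> r < r' ->
  sent_by_some (Leader r' w') -> w = w'.
Proof.
move=> hq; elim: r' => [//|r' IH]; rewrite ltnS leq_eqVlt => /orP[/eqP <-|hr].
  by move=> /ledS_concluded[_]; apply.
by move=> /ledS_concluded[/(IH hr)].
Qed.

Lemma vote_quorums_agree r1 r2 w1 w2 :
  vote_quorum r1 w1 -> vote_quorum r2 w2 -> w1 = w2.
Proof.
move=> h1 h2; have s1 := vote_quorum_sent h1; have s2 := vote_quorum_sent h2.
case: (ltngtP r1 r2) => hr; last by subst r2; exact: votes_agree s1 s2.
- exact: led_after_quorum h1 hr (vote_led s2).
- by apply/esym; exact: led_after_quorum h2 hr (vote_led s1).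
Qed.

(** Strong induction on the sending time: a relayed [Decide] leads to an earlier one, and an
    original one was broadcast at (9) on the evidence of a quorum. *)
Lemma decide_vote_quorum w : sent_by_some (Decide w) -> exists r, vote_quorum r w.
Proof.
move=> [i [t]]; elim/ltn_ind: t i => t IH i hs.
have hi := sent_sched hs; have := code_stepP hi; rewrite hs.
move=> /code_step_sent[/(receivable_sent hi)[j [u [ut hu]]]|]; first exact: IH hu.
move=> [hl hw [w' hw']]; rewrite /= in hl hw; exists (round (state e i t)).
have hq : vote_quorum (round (state e i t)) w'.
  apply: leq_trans hw' _; rewrite (received_state_next hi).
  exact: received_senders.
(* The broadcast carries the estimate, not the counted value [w']; [concluded] identifies the
   two. *)
have := estimate_invP i t; rewrite /estimate_inv hl hw => -[_ /(_ _ hq)].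
by move=> <-.
Qed.

Lemma decides_sent i t w : decides e i t = Some w -> sent_by_some (Decide w).
Proof.
move=> hd; exists i, t; have := code_stepP (decides_sched hd); rewrite hd.
by move E: (Some w) => d hs; case: hs E => // s w' _ _ [->].
Qed.

Lemma decides_agree i j t1 t2 w1 w2 :
  decides e i t1 = Some w1 -> decides e j t2 = Some w2 -> w1 = w2.
Proof.
move=> /decides_sent/decide_vote_quorum[r1 h1].
by move=> /decides_sent/decide_vote_quorum[r2]; exact: vote_quorums_agree h1.
Qed.

Lemma validity_holds : validity input e.
Proof.
move=> i t w /decides_sent/decide_vote_quorum[r].
by move=> /vote_quorum_sent/vote_led/led_input.
Qed.

(** * Halting and termination *)

Lemma halted_forever i t1 t2 : t1 <= t2 ->
  loc (state e i t1) = Halted -> loc (state e i t2) = Halted.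
Proof.
move=> /subnKC <- h1; elim: (t2 - t1) => [|d IH]; first by rewrite addn0.
rewrite addnS; set t := t1 + d in IH *.
case: (boolP (i \in sched e t)) => hi; last by rewrite state_idle.
exact: code_step_halted (code_stepP hi) IH.
Qed.

Lemma integrity_holds : integrity e.
Proof.
move=> i t1 t2 w1 w2; wlog lt12 : t1 t2 w1 w2 / t1 < t2 => [hw|].
  by case: (ltngtP t1 t2) => // lt12 h1 h2; [|apply/esym];
    [exact: hw lt12 h1 h2|exact: hw lt12 h2 h1].
move=> h1 h2.
have := code_stepP (decides_sched h1); rewrite h1 => /code_step_decision[_ hh].
have := code_stepP (decides_sched h2); rewrite h2 => /code_step_decision[[]].
by rewrite /= (halted_forever lt12 hh).
Qed.

Lemma halted_decided i t : loc (state e i t) = Halted ->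
  exists t' w, decides e i t' = Some w.
Proof.
elim: t => [|t IH]; first by rewrite state0.
case: (boolP (i \in sched e t)) => hi; last by rewrite state_idle.
by move=> /(code_step_halt (code_stepP hi))[/IH|[w hw]] //; exists t, w.
Qed.

Lemma scheduled i t : i \in correct F -> exists2 t', t <= t' & i \in sched e t'.
Proof. by case: he => _ [_ +] _ => /(_ i t). Qed.

Lemma sched_alive i t : i \in sched e t -> i \notin F t.
Proof. by case: he => _ [+ _] _; apply. Qed.

(** At its first scheduled step after the message has arrived, a correct process has either halted,
    hence decided, or is forced to decide by the priority of the handler. *)
Lemma decide_all_decide w i : sent_by_some (Decide w) -> i \in correct F ->
  exists t w', decides e i t = Some w'.
Proof.
move=> [j [u hu]] hi; have [T hT] := sent_received hi hu.
have [t /leqW/hT ht hs] := scheduled T hi.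
case: (pselect (loc (state e i t) = Halted)) => [/halted_decided //|hl].
rewrite -received_state_next // in ht.
have [w' hw'] := code_step_must_decide (code_stepP hs) hl ht.
by exists t, w'.
Qed.

(** * Liveness, assuming for contradiction that no [Decide] is ever sent *)

Section Undecided.
Hypothesis undecided : forall w, ~ sent_by_some (Decide w).

Lemma not_halted i t : loc (state e i t) <> Halted.
Proof. by move=> /halted_decided[u [w /decides_sent/undecided]]. Qed.

Lemma loop_stepP i t : i \in sched e t ->
  loop_step n f (H i t) (received_state i t) (sent e i t) (state e i t.+1).
Proof.
move=> hi; apply: (code_step_loop (code_stepP hi)); first exact: not_halted.
by move=> w; apply/negP => /(receivable_by_some hi)/undecided.
Qed.

Lemma progress_step i t :
  progress (state e i t) <= progress (state e i t.+1) <= (progress (state e i t)).+1.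
Proof.
case: (boolP (i \in sched e t)) => hi; last by rewrite state_idle // leqnn leqnSn.
exact: loop_step_progress (loop_stepP hi).
Qed.

(** A discrete intermediate value argument: [progress] starts at 0 and grows by at most one per time
    unit. *)
Lemma crossing i t k : k < progress (state e i t) ->
  exists2 u, i \in sched e u &
    progress (state e i u) = k /\ progress (state e i u.+1) = k.+1.
Proof.
elim: t => [|t IH]; first by rewrite state0.
move=> hk; have /andP[h1 h2] := progress_step i t.
case: (ltnP k (progress (state e i t))) => [/IH//|hk'].
case: (boolP (i \in sched e t)) => hi; last first.
  by move: hk; rewrite state_idle // ltnNge hk'.
by exists t => //; lia.
Qed.

(** At [Line9], unanimous votes would trigger a [Decide], which is excluded; hence the conclusion
    [False]. *)
Lemma crossing_sent i t k : k < progress (state e i t) ->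
  exists u, [/\ i \in sched e u, progress (state e i u) = k,
    progress (state e i u.+1) = k.+1 &
    match loc (state e i u) with
    | Line1 => exists w, sent_by_some (Leader (round (state e i u)) w)
    | Line3 => sent e i u =
               Some (Report (round (state e i u)) (estimate (state e i u)))
    | Line6 => sent e i u =
               Some (Vote (round (state e i u)) (aux (state e i u)))
    | Line9 => forall w, (forall a, sent_by_some (Vote (round (state e i u)) a) ->
                                    a = Some w) -> False
    | _ => True
    end].
Proof.
move=> /crossing[u hi [h1 h2]]; exists u; split=> //.
have := loop_step_sent (loop_stepP hi); 
rewrite -[progress (received_state _ _)]/(progress (state e i u)).
have hrec m := @receivable_by_some i u m hi.
have := quorum_inv_received i u; rewrite /quorum_inv h1 h2 => + /(_ (leqnn _)).
rewrite -[loc (received_state i u)]/(loc (state e i u)).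
rewrite -[round (received_state i u)]/(round (state e i u)).
case: (loc (state e i u)) => //.
- move=> _ [w [/hrec|hw]]; first by exists w.
  by exists w, i, u.
- move=> hv /(_ hv) hd w hw; have [|w' hw'] := hd.
    by exists w => a /hrec/hw.
  by apply: (@undecided w'); exists i, u.
Qed.

(** The time [T] is arbitrary, so the failing wait condition can be observed after any given
    messages have arrived. *)
Lemma stalled i r l t0 T : i \in correct F -> l <> Halted ->
  (forall t, t0 <= t -> progress (state e i t) = 9 * r + line_index l) ->
  exists2 t, T <= t &
    match l with
    | Line1 => ~~ H i t /\
               forall w, Leader r w \notin received (state e i t.+1)
    | Line4 => num_reports r (received (state e i t.+1)) < n - f
    | Line7 => num_votes r (received (state e i t.+1)) < n - f
    | _ => False
    end.
Proof.
move=> hi hl stay; have [t ht hs] := scheduled (maxn t0 T) hi.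
rewrite geq_max in ht; have /andP[t0t Tt] := ht; exists t => //.
have [el er] := progress_loc (@not_halted i t) hl (stay _ t0t).
have := loop_step_stuck (loop_stepP hs); rewrite (received_state_next hs) /= el er.
by apply; rewrite stay ?(leqW t0t) // -(stay _ t0t).
Qed.

Lemma progress_stuck i k : (exists t, k <= progress (state e i t)) ->
  ~ (exists t, k < progress (state e i t)) ->
  exists t0, forall t, t0 <= t -> progress (state e i t) = k.
Proof.
move=> [t0 ht0] hno; exists t0 => t ht; apply/eqP; rewrite eqn_leq.
rewrite (leq_trans ht0) ?progress_mono // andbT leqNgt; apply/negP => h.
by apply: hno; exists t.
Qed.

Hypothesis hF : failure_pattern f F.

(** Finitely many correct processes have a common bound on the arrival times of their messages, and
    there are at least [n - f] of them. The content [x] may vary with the sender, as reports and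
    votes do. *)
Lemma correct_quorum (T : finType) (g : T -> message) i : i \in correct F ->
  (forall j, j \in correct F -> exists x u, sent e j u = Some (g x)) ->
  exists t0, forall t, t0 <= t -> n - f <= \sum_x received (state e i t) (g x).
Proof.
move=> hi hsent.
have /fin_all_exists[u hu] : forall j, exists u, j \in correct F ->
    exists x, recv e i j u = Some (g x).
  move=> j; case: (boolP (j \in correct F)) => [/hsent[x [v hv]]|]; last by exists 0.
  by have [u hu] := sent_recv hi hv; exists u => _; exists x.
exists (\max_j u j).+1 => t ht.
apply: (@leq_trans #|correct F|).
  have := cardsC (crashed F); rewrite card_ord -/(correct F).
  by case: hF => _ _; lia.
rewrite -sum1_card [leqLHS]big_mkcond /=.
(* With the sum over senders outermost, each correct sender accounts for at least one reception. *)
under [leqRHS]eq_bigr do rewrite received_count exchange_big.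
rewrite exchange_big /=; apply: leq_sum => j _; case: ifP => // /hu[x hx].
have hut : u j < t by apply: leq_trans ht; rewrite ltnS (leq_bigmax j).
by rewrite (bigD1 x) //= (bigD1 (Ordinal hut)) //= hx eqxx.
Qed.

Hypothesis hH : eventual_self_trust F H.

(** Induction on [k] for all correct processes at once. One that never passes [k] is blocked at a
    waiting line, yet everybody has reached [k] and so made the broadcasts preceding that line. *)
Lemma reach k i : i \in correct F -> exists t, k <= progress (state e i t).
Proof.
elim: k i => [|k IH] i hi; first by exists 0.
apply: contrapT => hno; have [t0 stay] := progress_stuck (IH i hi) hno.
have [r [l [hl ek]]] : exists r l, l <> Halted /\ k = 9 * r + line_index l.
  exists (round (state e i t0)), (loc (state e i t0)).
  split; first exact: not_halted.
  by rewrite -(stay t0).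
have stall T := stalled T hi hl (fun t ht => etrans (stay t ht) ek).
have cross j c r' l' : j \in correct F -> k = c.+1 -> l' <> Halted ->
    c = 9 * r' + line_index l' ->
    exists u, [/\ loc (state e j u) = l', round (state e j u) = r' &
      match l' with
      | Line3 => sent e j u = Some (Report r' (estimate (state e j u)))
      | Line6 => sent e j u = Some (Vote r' (aux (state e j u)))
      | _ => True
      end].
  move=> hj kc hl' ec; have [t ht] := IH j hj; rewrite kc in ht.
  have [u [_ hu _ hs]] := crossing_sent ht; exists u.
  have [el er] := progress_loc (@not_halted j u) hl' (etrans hu ec).
  by move: hs; rewrite el er; split=> //; case: (l') hs.
case: l => // in hl ek stall.
(* Consider the eventual leader [p]: if it passes [k], leaving [Line1] yields a [Leader] message;
   otherwise it waits there forever, although its detector is eventually true. *)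
- have [w [j [u hw]]] : exists w, sent_by_some (Leader r w).
    have [tH [p [hp htrust]]] := hH.
    case: (pselect (exists t, k < progress (state e p t))) => [[t ht]|hnp].
      have [u [_ hu _]] := crossing_sent ht.
      by have [-> ->] := progress_loc (@not_halted p u) hl (etrans hu ek).
    have [t1 stayp] := progress_stuck (IH p hp) hnp.
    have [t ht [/negP[]]] :=
      stalled tH.+1 hp hl (fun t ht => etrans (stayp t ht) ek).
    by case: (htrust _ ht).
  have [T hT] := sent_received hi hw; have [t /leqW/hT ht [_ /(_ w)]] := stall T.
  by rewrite ht.
- by have [] := stall 0 => t _.
- have [|T hT] := correct_quorum (g := Report r) hi.
    move=> j hj; have [| |u [_ _ hu]] := @cross j _ r Line3 hj _ _ erefl => //.
      by rewrite ek addnS.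
    by exists (estimate (state e j u)), u.
  by have [t /leqW/hT] := stall T; rewrite leqNgt => /negP.
- by have [] := stall 0 => t _.
- by have [] := stall 0 => t _.
- have [|T hT] := correct_quorum (g := Vote r) hi.
    move=> j hj; have [| |u [_ _ hu]] := @cross j _ r Line6 hj _ _ erefl => //.
      by rewrite ek addnS.
    by exists (aux (state e j u)), u.
  by have [t /leqW/hT] := stall T; rewrite leqNgt => /negP.
- by have [] := stall 0 => t _.
- by have [] := stall 0 => t _.
- by have [] := stall 0 => t _.
Qed.

Lemma single_leader : exists p r, p \in correct F /\
  forall j t w, sent e j t = Some (Leader r w) -> j = p.
Proof.
have [tH [p [hp htrust]]] := hH.
have /fin_all_exists[u hu] : forall j, exists u, j \in crashed F -> j \in F u.
  move=> j; case: (boolP (j \in crashed F)) => [|_]; last by exists 0.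
  by rewrite inE => /asboolP[u hu]; exists u.
have hmono t1 t2 : t1 <= t2 -> F t1 \subset F t2.
  move=> /subnKC <-; elim: (t2 - t1) => [|d IH]; first by rewrite addn0.
  by rewrite addnS (subset_trans IH) //; case: hF.
(* After [T] the detector is stable and all faulty processes have crashed. The round chosen next
   exceeds every round reached by [T], so its [Leader] messages are sent no earlier than [T]. *)
pose T := maxn tH.+1 (\max_j u j).
exists p, (\max_j round (state e j T)).+1; split=> // j t w hs.
have hsch := sent_sched hs; have := code_stepP hsch; rewrite hs.
move=> /code_step_sent[_ _ _ hHj].
have [pj _] := sent_slot hs erefl.
have Tt : T <= t.
  rewrite leqNgt; apply/negP => /ltnW/(progress_mono j); rewrite pj /progress.
  have := leq_bigmax (F := fun j => round (state e j T)) j.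
  by case: (loc _) => /=; lia.
move: Tt; rewrite geq_max => /andP[tHt ut].
have hj : j \in correct F.
  rewrite inE; apply/negP => /[dup] /hu hju _.
  have /negP[] := sched_alive hsch; apply: (subsetP (hmono (u j) t _)) => //.
  by apply: leq_trans ut; exact: leq_bigmax.
apply/eqP/negPn/negP => jp; have [_ /(_ j)] := htrust t tHt.
by rewrite in_setD1 jp hj hHj => /(_ isT).
Qed.

Lemma undecided_absurd : False.
Proof.
have [p [r [hp hlead]]] := single_leader.
have hled w1 w2 : sent_by_some (Leader r w1) ->
    sent_by_some (Leader r w2) -> w1 = w2.
  move=> [j1 [t1 h1]] [j2 [t2 h2]].
  have e1 := hlead _ _ _ h1; have e2 := hlead _ _ _ h2; subst j1 j2.
  have t12 := sent_unique h1 h2 erefl erefl.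
  by move: h1; rewrite t12 h2 => -[].
(* Passing [Line9] of round [r] requires passing [Line1], which supplies the value [w]; all votes of
   the round are then shown to be for [w]. *)
have [t ht] := reach (9 * r + line_index Line9).+1 hp.
have ht1 : 9 * r + line_index Line1 < progress (state e p t).
  by move: ht => /=; lia.
have [u1 [_ p1 _ s1]] := crossing_sent ht1.
have [u2 [_ p2 _ s2]] := crossing_sent ht.
have [//|l1 r1] := progress_loc (@not_halted p u1) _ p1.
have [//|l2 r2] := progress_loc (@not_halted p u2) _ p2.
rewrite l1 r1 in s1; rewrite l2 r2 in s2; have [w hw] := s1; apply: (s2 w) => -[b|].
  by move=> /vote_led hb; congr Some; exact: hled hb hw.
(* A vote for ? means that both values were reported, hence both led, against the uniqueness in
   [hled]. *)
move=> hnone; suff : true = false by [].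
by apply: hled; apply/report_led/vote_none_reported.
Qed.

End Undecided.

Lemma termination_holds : failure_pattern f F -> eventual_self_trust F H ->
  termination F e.
Proof.
move=> hF hH i hi; have [w hw] : exists w, sent_by_some (Decide w).
  apply: contrapT => hno; apply: undecided_absurd => // w hw.
  by apply: hno; exists w.
exact: decide_all_decide hw hi.
Qed.

End Execution.

Theorem theorem2p13 (n f : nat) (hnf : 2 * f < n)
    (F : nat -> {set 'I_n}) (hF : failure_pattern f F)
    (H : 'I_n -> nat -> bool) (hH : eventual_self_trust F H)
    (input : 'I_n -> bool) (e : execution n)
    (he : is_execution f F H input e) :
  [/\ termination F e, integrity e, agreement F e & validity input e].
Proof.
split.
- exact: termination_holds he hnf hF hH.
- exact: integrity_holds he.
- by move=> i j t1 t2 w1 w2 _ _; exact: decides_agree he hnf _ _ _ _ _ _.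
- exact: validity_holds he hnf.
Qed.
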